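(* Let $(S,\Sigma,\delta)$ be an HMM with $\epsilon$-transitions with current parameters $\theta^{t}$ (i.e. $\delta=\delta(\cdot\mid\theta^{t})$), such that from each state there is an outgoing path of non-zero probability containing a symbol in $\Sigma$. Let $s_0\in S$ and let $\widetilde{y}\in\Sigma^n$ be an observation sequence with $P_{s_0}(Y=\widetilde{y}\mid\theta^{t})>0$. Then for every parameter setting $\theta$ $$Q(\theta\mid\theta^{t})=\sum_{s\in S}\ \sum_{\mathsf{t}=(s,a,s')\in T_\delta}\log\delta(\mathsf{t}\mid\theta)\cdot E_{s_0}[X_{\mathsf{t}}\mid Y=\widetilde{y},\theta^{t}].$$ Moreover, the value $Q(\theta\mid\theta^{t})$ is maximal (among all parameter settings $\theta$) when the parameters $\theta$ are as follows: for every transition $\mathsf{t}$, $\delta(\mathsf{t}\mid\theta)$ is set proportional to $E_{s_0}[X_{\mathsf{t}}\mid Y=\widetilde{y},\theta^{t}]$. That is, for each state $s$ and each $\mathsf{t}\in T^s_\delta$, $$\delta(\mathsf{t}\mid\theta)=\frac{E_{s_0}[X_{\mathsf{t}}\mid Y=\widetilde{y},\theta^{t}]}{\sum_{\mathsf{t}'\in T^s_\delta}E_{s_0}[X_{\mathsf{t}'}\mid Y=\widetilde{y},\theta^{t}]}$$ whenever the denominator is non-zero, while for states $s$ for which the denominator is zero the previous parameters are kept, i.e. $\delta(\mathsf{t}\mid\theta)=\delta(\mathsf{t}\mid\theta^{t})$ for $\mathsf{t}\in T^s_\delta$.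
   Context: An HMM with $\epsilon$-transitions is a triple $(S,\Sigma,\delta)$ with a finite state space $S$, an alphabet $\Sigma$ (a finite set of observable symbols, with $\epsilon\notin\Sigma$) and a transition function $\delta\colon S\to\mathcal{D}((\Sigma\cup\{\epsilon\})\times S)$, where $\mathcal{D}(X)$ is the set of probability functions $P\colon X\to[0,1]$ with $\sum_{x}P(x)=1$. Its set of transitions is $T_\delta=\{(s,a,s')\mid s,s'\in S,\ a\in\Sigma\cup\{\epsilon\},\ \delta(s)(a,s')>0\}$, and $T^s_\delta=T_\delta\cap(\{s\}\times(\Sigma\cup\{\epsilon\})\times S)$. An outgoing path of $s$ of non-zero probability is a sequence $s=r_0,b_1,r_1,\dots,b_m,r_m$ with $r_i\in S$, $b_i\in\Sigma\cup\{\epsilon\}$ and $\delta(r_{i-1})(b_i,r_i)>0$ for all $i$; it contains a symbol in $\Sigma$ if some $b_i\in\Sigma$. The graph structure $T_\delta$ is fixed; a parameter setting $\theta$ consists of transition probabilities on this graph: values $\delta(\mathsf{t}\mid\theta)\in[0,1]$ for $\mathsf{t}\in T_\delta$ with $\sum_{\mathsf{t}\in T^s_\delta}\delta(\mathsf{t}\mid\theta)=1$ for each $s\in S$ (all triples outside $T_\delta$ have probability $0$). For $\mathsf{t}=(s,a,s')$, $\delta(\mathsf{t}\mid\theta)$ stands for $\delta(s)(a,s')$ under the parameters $\theta$. $\theta^{t}$ is the current parameter setting (the superscript $t$ is an iteration index, unrelated to transitions $\mathsf{t}$), and $T_\delta$ is the set of transitions that are positive under $\theta^{t}$. Conditioning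 on $\theta$ in probabilities and expectations indicates which parameters are used. For $s_0\in S$ and $n\in\mathbb{N}_0$, $\Omega^n_{s_0}=s_0((\epsilon S)^*\Sigma S)^n$ is the set of alternating sequences $\widetilde{z}=s_0a_1s_1\dots a_ms_m$ with $s_i\in S$, $a_i\in\Sigma\cup\{\epsilon\}$, exactly $n$ of the $a_i$ in $\Sigma$, and (if $n\ge1$) $a_m\in\Sigma$; $\Omega^0_{s_0}=\{s_0\}$. The probability of $\widetilde{z}$ under $\theta$ is $P(Z=\widetilde{z}\mid\theta)=\prod_{i=1}^m\delta((s_{i-1},a_i,s_i)\mid\theta)$ (empty product $=1$). Random variables on $\Omega^n_{s_0}$: $Z$ is the identity; $Y(\widetilde{z})\in\Sigma^n$ is the word of observable symbols of $\widetilde{z}$ (states and $\epsilon$'s removed); $X_{\mathsf{t}}(\widetilde{z})\in\mathbb{N}_0$ is the number of $i$ with $(s_{i-1},a_i,s_i)=\mathsf{t}$. Hence $P(Y=\widetilde{y},Z=\widetilde{z}\mid\theta)$ equals $P(Z=\widetilde{z}\mid\theta)$ if $Y(\widetilde{z})=\widetilde{y}$ and $0$ otherwise, and $P_{s_0}(Y=\widetilde{y}\mid\theta)$ is the sum of these values over $\widetilde{z}\in\Omega^n_{s_0}$ with $n=|\widetilde{y}|$. Moreover $E_{s_0}[X_{\mathsf{t}}\mid Y=\widetilde{y},\theta^{t}]=\sum_{\widetilde{z}\in\Omega^n_{s_0}}X_{\mathsf{t}}(\widetilde{z})\cdot P(Z=\widetilde{z}\mid Y=\widetilde{y},\theta^{t})$.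 The function $Q$ (of the expectation-maximization algorithm) is $$Q(\theta\mid\theta^{t})=E_{Z\mid Y,\theta^{t}}[\log P(Y,Z\mid\theta)]=\sum_{\widetilde{z}\in\Omega^n_{s_0}}\log P(Y=\widetilde{y},Z=\widetilde{z}\mid\theta)\cdot P(Z=\widetilde{z}\mid Y=\widetilde{y},\theta^{t}),$$ with values in $\mathbb{R}\cup\{-\infty\}$ and the conventions $\log 0=-\infty$ and $0\cdot(-\infty)=0$. *)

(* Defs.v *)
From HB Require Import structures.
From mathcomp Require Import all_boot all_order all_algebra.
From mathcomp Require Import all_classical all_reals all_analysis.

Set Implicit Arguments.
Unset Strict Implicit.
Unset Printing Implicit Defensive.

Import Order.TTheory GRing.Theory Num.Theory.

Local Open Scope ring_scope.

Record prob_fun (R : realType) (X : finType) := ProbFun {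
  pval :> X -> R;
  pval_itv : forall x, 0 <= pval x <= 1;
  pval_sum : \sum_x pval x = 1 }.

(* The letter [None : option Sigma] is epsilon; a triple [(s, a, s')] is a
   potential transition from [s] to [s'] emitting [a]. *)
Definition transition (S Sigma : finType) : finType := (S * option Sigma * S)%type.

(* [(r, [:: (b_1, r_1); ...; (b_m, r_m)])] is the alternating sequence
   r b_1 r_1 ... b_m r_m. *)
Definition run (S Sigma : finType) : choiceType :=
  (S * seq (option Sigma * S))%type.

Fixpoint steps_from (S Sigma : finType) (r : S) (p : seq (option Sigma * S)) :
    seq (transition S Sigma) :=
  if p is (b, r') :: p' then (r, b, r') :: steps_from r' p' else [::].

Definition steps (S Sigma : finType) (z : run S Sigma) : seq (transition S Sigma) :=
  steps_from z.1 z.2.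

Definition observed (S Sigma : finType) (z : run S Sigma) : seq Sigma :=
  pmap fst z.2.

Definition Omega (S Sigma : finType) (s0 : S) (n : nat) : set (run S Sigma) :=
  [set z | [/\ z.1 = s0,
               size (observed z) = n
             & if n is 0 then z.2 = [::] else isSome (last (None, s0) z.2).1]]%classic.

Definition occurrences (S Sigma : finType) (t : transition S Sigma)
  (z : run S Sigma) : nat := count_mem t (steps z).

Section HMM.
Variables (R : realType) (S Sigma : finType).
Implicit Types (delta : S -> prob_fun R (option Sigma * S)%type).
Implicit Types (theta : transition S Sigma -> R) (t : transition S Sigma).
Implicit Types (y : seq Sigma) (z : run S Sigma) (s : S).

Definition params_of delta : transition S Sigma -> R :=
  fun t => delta t.1.1 (t.1.2, t.2).

Definition transitions delta : {set transition S Sigma} :=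
  [set t | 0 < params_of delta t]%SET.

Definition transitions_from delta s : {set transition S Sigma} :=
  [set t in transitions delta | t.1.1 == s]%SET.

Definition can_emit delta s : Prop :=
  exists z : run S Sigma,
    [/\ z.1 = s,
        {in steps z, forall t, 0 < params_of delta t}
      & exists2 c, c \in z.2 & isSome c.1].

Definition parameter_setting delta theta : Prop :=
  [/\ {in transitions delta, forall t, 0 <= theta t <= 1},
      forall t, t \notin transitions delta -> theta t = 0
    & forall s, \sum_(t in transitions_from delta s) theta t = 1].

Definition prob_run theta z : R := \prod_(t <- steps z) theta t.

(* P(Y = y, Z = z | theta) *)
Definition prob_joint theta y z : R :=
  if observed z == y then prob_run theta z else 0.

Local Open Scope ereal_scope.

(* P_{s0}(Y = y | theta) *)
Definition prob_obs theta s0 y : \bar R :=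
  \esum_(z in Omega s0 (size y)) (prob_joint theta y z)%:E.

(* P(Z = z | Y = y, theta) *)
Definition prob_cond theta s0 y z : \bar R :=
  (prob_joint theta y z)%:E / prob_obs theta s0 y.

(* E_{s0}[X_t | Y = y, theta] *)
Definition expected_occ theta s0 y t : \bar R :=
  \esum_(z in Omega s0 (size y))
    (occurrences t z)%:R%:E * prob_cond theta s0 y z.

(* [esum] is only meaningful for nonnegative families (it is a supremum of
   finite partial sums), hence the splitting into positive and negative parts. *)
Definition signed_esum (T : choiceType) (D : set T) (f : T -> \bar R) : \bar R :=
  (\esum_(x in D) f^\+ x) - (\esum_(x in D) f^\- x).

(* Q(theta | theta'): [lne 0 = -oo] and [-oo * 0 = 0] hold in [\bar R]. *)
Definition Qfun s0 y theta theta' : \bar R :=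
  signed_esum (Omega s0 (size y))
    (fun z => lne (prob_joint theta y z)%:E * prob_cond theta' s0 y z).

End HMM.

(* Main.v *)
(* On the runs with positive posterior weight, [- log P(Y, Z | theta)] is the sum
   over [t] of [X_t * (- log theta t)], a nonnegative quantity, so the formula for
   [Q] follows by exchanging sums, with infinite values allowed.  Maximality is
   Gibbs' inequality at each state, which requires the expected counts to be
   finite.  They are dominated by the expected run length: since every state can
   emit, there is [W >= 0] with [1 + sum_s' delta(s, eps, s') W(s') <= W(s)], and
   then [W(s) + k * sum W] bounds the expected number of steps from [s] until
   [k] symbols have been emitted. *)
Require Import Defs.
From HB Require Import structures.
From mathcomp Require Import all_boot all_order all_algebra.
From mathcomp Require Import finmap all_classical all_reals all_analysis.
Import Order.TTheory GRing.Theory Num.Theory.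
Local Open Scope ring_scope.
Local Open Scope ereal_scope.

Set Implicit Arguments.
Unset Strict Implicit.
Unset Printing Implicit Defensive.

(** * Exhausting the set of paths by words of bounded length *)

Section Words.
Variable T : finType.

(** Lengths up to [L] are all included: every finite set of paths lies in one such list, so bounds
    uniform in [L] carry over to infinite nonnegative sums. *)
Fixpoint words (L : nat) : seq (seq T) :=
  [::] :: if L is L'.+1 then [seq c :: q | c <- enum T, q <- words L'] else [::].

Lemma mem_words L p : (p \in words L) = (size p <= L)%N.
Proof.
elim: L p => [|L IHL] [|c p] //=; rewrite in_cons /=.
apply/allpairsP/idP => [[[d q] /= [_ + [_ ->]]]|pL]; first by rewrite IHL.
by exists (c, p); rewrite /= mem_enum IHL.
Qed.

Lemma words_uniq L : uniq (words L).
Proof.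
elim: L => [|L IHL] //=; apply/andP; split; first by apply/allpairsP => -[[? ?] []].
by apply: allpairs_uniq; rewrite ?enum_uniq// => -[? ?] [? ?] _ _ [-> ->].
Qed.

Lemma big_wordsS (V : nmodType) L (F : seq T -> V) :
  (\sum_(p <- words L.+1) F p =
   F [::] + \sum_(c : T) \sum_(q <- words L) F (c :: q))%R.
Proof. by rewrite big_cons big_allpairs_dep big_enum. Qed.

End Words.

(** * Expected number of steps until a given number of symbols is emitted *)

Section Length.
Local Open Scope ring_scope.
Variables (R : realType) (S Sigma : finType).
Variable delta : S -> prob_fun R (option Sigma * S)%type.
Implicit Types (s : S) (c : (option Sigma * S)%type).
Implicit Types (p q : seq (option Sigma * S)).

Let delta_ge0 s c : 0 <= delta s c.
Proof. by have /andP[] := pval_itv (delta s) c. Qed.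

Lemma mean_le_const s (g : option Sigma * S -> R) (x : R) :
  (forall c, g c <= x) -> \sum_c delta s c * g c <= x.
Proof.
move=> g1; rewrite -[leRHS]mul1r -(pval_sum (delta s)) mulr_suml.
by apply: ler_sum => c _; apply: ler_wpM2l.
Qed.

Lemma mean_lt1 s (g : option Sigma * S -> R) c0 : (forall c, g c <= 1) ->
  0 < delta s c0 -> g c0 < 1 -> \sum_c delta s c * g c < 1.
Proof.
move=> g1 d0 gc0; rewrite -(pval_sum (delta s)) (bigD1 c0)//= [ltRHS](bigD1 c0)//=.
apply: ltr_leD; first by rewrite gtr_pMr.
by apply: ler_sum => c _; rewrite ler_piMr.
Qed.

Fixpoint silent_prob k s : R :=
  if k is k'.+1 then
    \sum_c delta s c * (if isSome c.1 then 0 else silent_prob k' c.2)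
  else 1.

Lemma silent_prob_ge0 k s : 0 <= silent_prob k s.
Proof.
elim: k s => [|k IHk] s //=; apply: sumr_ge0 => c _.
by apply: mulr_ge0 => //; case: ifP.
Qed.

Lemma silent_prob_le1 k s : silent_prob k s <= 1.
Proof.
elim: k s => [|k IHk] s //=; apply: mean_le_const => c.
by case: ifP => // _; exact: ler01.
Qed.

Lemma silent_prob_decr s : {homo silent_prob^~ s : k l / (k <= l)%N >-> l <= k}.
Proof.
apply: homo_leq => [x //|x y z xy yz|k]; first exact: le_trans yz xy.
elim: k s => [|k IHk] s; first exact: silent_prob_le1.
apply: ler_sum => c _; apply: ler_wpM2l => //.
by case: ifP => // _; exact: IHk.
Qed.

(** Induction along the emitting path: emitting at once gives [k = 1], and after an epsilon the
    strict bound at the next state passes back through a transition of positive probability. *)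
Lemma silent_prob_lt1 s : can_emit delta s -> exists k, silent_prob k s < 1.
Proof.
move=> [[r p] /= [-> {r}]]; rewrite /steps /=.
elim: p s => [|[b r] p IHp] s; first by move=> _ [].
move=> pos [c cp cS].
have d0 : 0 < delta s (b, r) by have := pos (s, b, r); rewrite inE eqxx; apply.
have le1 k (c' : option Sigma * S) :
    (if isSome c'.1 then 0 else silent_prob k c'.2) <= 1.
  by case: ifP => // _; exact: silent_prob_le1.
case: b d0 pos cp => [a|] d0 pos cp.
  by exists 1%N; apply: (mean_lt1 (le1 0%N) d0) => /=.
have [k kr] : exists k, silent_prob k r < 1.
  apply: IHp => [t tp|]; first by apply: pos; rewrite inE tp orbT.
  exists c => //; move: cp; rewrite inE => /orP[/eqP ce|//].
  by rewrite ce in cS.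
by exists k.+1; apply: (mean_lt1 (le1 k) d0).
Qed.

(* With [u k] the probability of [k] silent steps and [u N < 1] everywhere, a
   large multiple of [u 0 + ... + u N.-1] has this drift, by telescoping. *)
Lemma emission_time_supersolution (emits : forall s, can_emit delta s) :
  exists W : S -> R, forall s,
    0 <= W s /\ 1 + \sum_c delta s c * (if isSome c.1 then 0 else W c.2) <= W s.
Proof.
have [N uN] : exists N, forall s, silent_prob N s < 1.
  pose K s := projT1 (cid (silent_prob_lt1 (emits s))).
  exists (\max_s K s)%N => s; apply: le_lt_trans (projT2 (cid (silent_prob_lt1 (emits s)))).
  by apply: silent_prob_decr; exact: leq_bigmax.
(* All summands are nonnegative, so [a * (1 - silent_prob N s) >= 1] for every [s]; this is what
   remains to be shown after telescoping. *)
pose a := \sum_s (1 - silent_prob N s)^-1.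
have ge0 s : 0 <= (1 - silent_prob N s)^-1 by rewrite invr_ge0 subr_ge0 ltW.
have a0 : 0 <= a by apply: sumr_ge0.
exists (fun s => a * \sum_(k < N) silent_prob k s) => s; split.
  by apply: mulr_ge0 => //; apply: sumr_ge0 => k _; exact: silent_prob_ge0.
have -> : \sum_c delta s c *
    (if isSome c.1 then 0 else a * \sum_(k < N) silent_prob k c.2) =
    a * \sum_(k < N) silent_prob k.+1 s.
  rewrite /= exchange_big/= mulr_sumr; apply: eq_bigr => c _.
  rewrite -mulr_sumr mulrCA; congr (_ * _).
  by case: ifP => // _; rewrite big1 ?mulr0.
have <- : \sum_(k < N) silent_prob k s + silent_prob N s - 1 =
    \sum_(k < N) silent_prob k.+1 s.
  rewrite -(big_ord_recr N (fun k => silent_prob k s)) big_ord_recl/=.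
  by rewrite addrAC subrr add0r.
rewrite -[X in a * X]addrA mulrDr addrCA gerDl -[X in a * X]opprB mulrN subr_le0.
rewrite -[leLHS](@mulVf _ (1 - silent_prob N s)) ?subr_eq0 ?gt_eqF//.
apply: ler_wpM2r; first by rewrite subr_ge0 ltW.
by rewrite /a (bigD1 s)//= lerDl sumr_ge0.
Qed.

(* Membership in [Omega s0 k], recast as a recursion on the path. *)
Fixpoint stops k p : bool :=
  if p is c :: q then (0 < k)%N && stops (if isSome c.1 then k.-1 else k) q
  else k == 0%N.

(** Weight of [p] as a path from [s] of the chain halted at its [k]-th emission. *)
Definition stopped_prob k s p : R :=
  if stops k p then prob_run (params_of delta) (s, p) else 0.

Lemma prob_run_ge0 z : 0 <= prob_run (params_of delta) z.
Proof. by apply: prodr_ge0 => t _; exact: delta_ge0. Qed.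

Lemma stopped_prob_ge0 k s p : 0 <= stopped_prob k s p.
Proof. by rewrite /stopped_prob; case: ifP => // _; exact: prob_run_ge0. Qed.

Lemma stopped_prob_cons k s c q : stopped_prob k.+1 s (c :: q) =
  delta s c * stopped_prob (if isSome c.1 then k else k.+1) c.2 q.
Proof.
case: c => b r; rewrite /stopped_prob /=; case: ifP => _; last by rewrite mulr0.
by rewrite /prob_run /steps/= big_cons.
Qed.

(** Distinct halted paths are disjoint events; the induction on [L] conditions on the first step. *)
Lemma total_stopped_prob_le1 k s L : \sum_(p <- words _ L) stopped_prob k s p <= 1.
Proof.
elim: L k s => [|L IHL] k s.
  rewrite big_seq1 /stopped_prob; case: ifP => _; last exact: ler01.
  by rewrite /prob_run big_nil.
rewrite big_wordsS; case: k => [|k].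
  rewrite [X in _ + X]big1 ?addr0 => [|c _]; last by rewrite big1.
  by rewrite /stopped_prob/= /prob_run big_nil.
rewrite {1}/stopped_prob/= add0r.
under eq_bigr do (under eq_bigr do rewrite stopped_prob_cons; rewrite -mulr_sumr).
exact: mean_le_const.
Qed.

Lemma expected_length_bounded (emits : forall s, can_emit delta s) k s :
  exists C : R,
    forall L, \sum_(p <- words _ L) (size p)%:R * stopped_prob k s p <= C.
Proof.
have [W W_spec] := emission_time_supersolution emits.
have W0 r : 0 <= W r by have [] := W_spec r.
pose M := \sum_r W r.
have WM r : W r <= M by rewrite /M (bigD1 r)//= lerDl sumr_ge0.
have M0 : 0 <= M by apply: sumr_ge0.
(* [M] dominates every [W r]: an emission, which may land in any state, is paid for by the drop of
   [k] by one. *)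
exists (W s + k%:R * M) => L; elim: L k s => [|L IHL] k s.
  by rewrite big_seq1 mul0r addr_ge0// mulr_ge0.
rewrite big_wordsS mul0r add0r; case: k => [|k].
  rewrite big1 ?mul0r ?addr0// => c _.
  by rewrite big1// => q _; rewrite mulr0.
(* Lengthening every continuation by the first step adds their total weight, at most 1; the
   induction hypothesis bounds the rest. *)
apply: (@le_trans _ _ (\sum_c delta s c *
  (1 + k.+1%:R * M + (if isSome c.1 then 0 else W c.2)))).
  apply: ler_sum => c _.
  under eq_bigr do rewrite stopped_prob_cons mulrCA -natr1 mulrDl mul1r.
  rewrite -mulr_sumr big_split/= ler_wpM2l// [leLHS]addrC.
  case: ifP => cS; rewrite -addrA lerD ?total_stopped_prob_le1//.
    rewrite addr0; apply: le_trans (IHL _ _) _.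
    by rewrite -natr1 mulrDl mul1r addrC lerD2l.
  by rewrite addrC.
under eq_bigr do rewrite mulrDr.
rewrite big_split/= -mulr_suml pval_sum mul1r addrAC lerD2r.
by have [] := W_spec s.
Qed.

Lemma stops_Omega s0 n s p : Omega s0 n (s, p) -> stops n p.
Proof.
rewrite /Omega /observed /= => -[_].
elim: p n {s} => [|c p IHp] n; first by move=> <-.
case: n => [//|n] /= hs; case: c hs => [[a|] r] /= [hs] hl.
  case: n hs hl => [|n] hs hl.
    (* The last symbol is used up, so a nonempty remainder would be silent, contrary to the symbol
       at its end. *)
    case: p hs hl {IHp} => [//|d p] /= hs.
    elim: p d hs => [|e p IHp] d /=; first by case: d => [[]].
    by case: d => [[]//] /= ? hs; exact: IHp.
  by apply: IHp => //; case: p hs hl.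
by apply: IHp => //; case: p hs hl.
Qed.

Lemma prob_joint_le_stopped s0 y z : Omega s0 (size y) z ->
  prob_joint (params_of delta) y z <= stopped_prob (size y) s0 z.2.
Proof.
case: z => s p Oz; have [/= <- _ _] := Oz.
rewrite /prob_joint /stopped_prob (stops_Omega Oz); case: ifP => // _.
exact: prob_run_ge0.
Qed.

End Length.

(** * Sums in the extended reals, Gibbs' inequality and sums over runs *)

Section Esum.
Variable R : realType.

(** The factor [+oo] is allowed because [- lne (theta t)%:E] is infinite where [theta t = 0]. *)
Lemma ge0_esumZl (T : choiceType) (D : set T) (c : \bar R) (f : T -> \bar R) :
  0 <= c -> (forall x, 0 <= f x) ->
  \esum_(x in D) (c * f x) = c * \esum_(x in D) f x.
Proof.
move=> + f0; case: c => [c c0| _|//].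
- rewrite /esum -ereal_supZl//; last first.
    by apply/set0P; exists (\sum_(x \in set0) f x), set0 => //; exact: fsets_set0.
  congr ereal_sup; rewrite image_comp; apply: eq_imagel => X _ /=.
  by rewrite ge0_mule_fsumr.
(* For [c = +oo], either all terms on [D] vanish and [+oo * 0 = 0] applies, or one positive term
   makes both sides [+oo]. *)
have [f00|/existsNP[x /not_implyP[Dx fx]]] := pselect (forall x, D x -> f x = 0).
  by rewrite !esum1 ?mule0// => x /f00 ->; rewrite mule0.
have fx0 : 0 < f x by rewrite lt0e f0 andbT; apply/eqP.
have sub : fsets D [set x]%classic by split => // _ ->.
have gef : 0 < \esum_(x in D) f x.
  by apply/(lt_le_trans fx0)/esum_ge; exists [set x]%classic; rewrite ?fsbig_set1.
rewrite gt0_mulye//; apply/eqP; rewrite -leye_eq; apply: esum_ge.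
by exists [set x]%classic; rewrite ?fsbig_set1// gt0_mulye.
Qed.

Lemma signed_esumN (T : choiceType) (D : set T) (f g : T -> \bar R) :
  (forall x, D x -> f x = - g x) -> (forall x, 0 <= g x) ->
  signed_esum D f = - \esum_(x in D) g x.
Proof.
move=> fg g0; rewrite /signed_esum esum1 ?sub0e => [|x Dx]; last first.
  by rewrite funeposE fg//; apply/max_idPr; rewrite oppe_le0.
congr (- _); apply: eq_esum => x Dx.
by rewrite funenegE fg// oppeK; apply/max_idPl.
Qed.

(** A zero factor makes both sides [+oo]; no summand is [-oo], so nothing indeterminate arises. *)
Lemma lne_prod (I : Type) (r : seq I) (F : I -> R) :
  (forall i, 0 <= F i <= 1)%R ->
  - lne (\prod_(i <- r) F i)%R%:E = \sum_(i <- r) - lne (F i)%:E.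
Proof.
move=> F01; elim: r => [|i r IHr]; first by rewrite !big_nil lne1 oppe0.
have Fge0 j : (0 <= F j)%R by case/andP: (F01 j).
rewrite !big_cons -IHr; have : (0 <= \prod_(j <- r) F j)%R by exact: prodr_ge0.
rewrite le_eqVlt => /predU1P[<-|P0].
  rewrite mulr0 /= lexx addey//; case: ifP => // _.
have := Fge0 i; rewrite le_eqVlt => /predU1P[<-|Fi0].
  rewrite mul0r /= lexx addye//; case: ifP => // _.
by rewrite !lne_EFin ?mulr_gt0// lnM// EFinD fin_num_oppeD.
Qed.

(** This brings in the counts X_t: it regroups the logarithms along a run by transition. *)
Lemma sum_count_mem (T : finType) (r : seq T) (F : T -> \bar R) :
  \sum_(t <- r) F t = \sum_(t : T) (count_mem t r)%:R%:E * F t.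
Proof.
elim: r => [|c r IHr].
  by rewrite big_nil big1// => t _; rewrite mul0e.
rewrite big_cons IHr; under [RHS]eq_bigr do
  rewrite /= natrD EFinD ge0_muleDl ?lee_fin//.
rewrite big_split/=; congr (_ + _).
rewrite (bigD1 c)//= eqxx mul1e big1 ?adde0// => t.
by rewrite eq_sym => /negbTE ->; rewrite mul0e.
Qed.

(* Gibbs' inequality, from [ln u <= u - 1] applied to [u = x t * d / e t]. *)
Lemma gibbs_inequality (T : finType) (A : {set T}) (e x : T -> R) :
  let d := (\sum_(t in A) e t)%R in
  {in A, forall t, 0 <= e t}%R -> {in A, forall t, 0 <= x t}%R ->
  (\sum_(t in A) x t <= 1)%R -> d != 0%R ->
  \sum_(t in A) lne (x t)%:E * (e t)%:E <=
  \sum_(t in A) lne (e t / d)%:E * (e t)%:E.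
Proof.
move=> d e0 x0 x1 dn0.
have d0 : (0 < d)%R by rewrite lt0r dn0 sumr_ge0.
have lneE t : t \in A -> lne (e t / d)%:E * (e t)%:E = (ln (e t / d) * e t)%:E.
  move=> tA; have := e0 _ tA; rewrite le_eqVlt => /predU1P[<-|et0].
    by rewrite mule0 mulr0.
  by rewrite lne_EFin// divr_gt0.
(* The corrections [d * x t - e t] add up to at most 0, since [x] sums to at most 1 and [e] to
   [d]. *)
have le t : t \in A -> lne (x t)%:E * (e t)%:E <=
    (ln (e t / d) * e t + (d * x t - e t))%:E.
  move=> tA; have := e0 _ tA; rewrite le_eqVlt => /predU1P[<-|et0].
    by rewrite mule0 mulr0 add0r subr0 lee_fin mulr_ge0 ?x0// ltW.
  have := x0 _ tA; rewrite le_eqVlt => /predU1P[<-|xt0].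
    by rewrite /= lexx gt0_mulNye// leNye.
  rewrite lne_EFin// -EFinM lee_fin -lerBlDl -mulrBl -ln_div ?posrE ?divr_gt0//.
  have -> : (d * x t - e t = (x t / (e t / d) - 1) * e t)%R.
    by rewrite mulrBl mul1r invf_div mulrA mulfVK ?gt_eqF// mulrC.
  apply: ler_wpM2r; first exact: ltW.
  rewrite -[X in ln X](subrKC 1)%R; apply: le_ln1Dx.
  by rewrite ltrBrDl subrr !divr_gt0.
apply: (le_trans (lee_sum _ le)); rewrite (eq_bigr _ lneE) !sumEFin lee_fin.
by rewrite big_split/= gerDl sumrB -mulr_sumr subr_le0 ger_pMr.
Qed.

(** An [esum] is a supremum over finite sets of runs. With the common start [s0] a run is determined
    by its path, so such a set embeds into [words _ L] for the largest length [L] in it. *)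
Lemma esum_runs_le (S Sigma : finType) (s0 : S) (D : set (run S Sigma))
    (f : run S Sigma -> \bar R) (g : seq (option Sigma * S) -> R) (C : R) :
  (forall z, D z -> z.1 = s0 /\ f z <= (g z.2)%:E) ->
  (forall p, 0 <= g p)%R ->
  (forall L, \sum_(p <- words _ L) g p <= C)%R ->
  \esum_(z in D) f z <= C%:E.
Proof.
move=> Dfg g0 gC; apply: ge_ereal_sup => _ [X [finX XD] <-].
rewrite fsbig_finite//=; set Y := enum_fset (fset_set X).
have YD z : z \in Y -> D z by rewrite in_fset_set// inE; exact: XD.
apply: (@le_trans _ _ (\sum_(z <- Y) (g z.2)%:E)).
  rewrite big_seq [leRHS]big_seq; apply: lee_sum => z /YD Dz.
  by have [] := Dfg z Dz.
rewrite sumEFin lee_fin -(big_map snd xpredT g).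
apply: le_trans (gC (\max_(z <- Y) size z.2)%N).
have uY : uniq [seq z.2 | z <- Y].
  rewrite map_inj_in_uniq ?fset_uniq// => -[s p] [s' p'] /YD/Dfg[/= -> _].
  by move=> /YD/Dfg[/= -> _] ->.
set W := words _ _.
have sub : {subset [seq z.2 | z <- Y] <= W}.
  move=> _ /mapP[z zY ->]; rewrite mem_words.
  exact: (@leq_bigmax_seq _ _ xpredT (fun z : run S Sigma => size z.2)).
have pW : perm_eq [seq z.2 | z <- Y] [seq p <- W | p \in [seq z.2 | z <- Y]].
  apply: uniq_perm; rewrite ?filter_uniq ?words_uniq// => p.
  by rewrite mem_filter; case: (boolP (p \in map _ _)) => // /sub ->.
rewrite (perm_big _ pW)/= big_filter big_mkcond/=.
by apply: ler_sum => p _; case: ifP.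
Qed.

End Esum.

(** * Posterior weights, expected counts, [Q] and the reestimated parameters *)

Section Posterior.
Variables (R : realType) (S Sigma : finType).
Variable delta : S -> prob_fun R (option Sigma * S)%type.
Variables (s0 : S) (y : seq Sigma).
Hypothesis y_pos : 0 < prob_obs (params_of delta) s0 y.

Let thetat := params_of delta.
Let E := expected_occ thetat s0 y.

Lemma prob_joint_ge0 z : (0 <= prob_joint thetat y z)%R.
Proof. by rewrite /prob_joint; case: ifP => // _; exact: prob_run_ge0. Qed.

Lemma prob_obs_fin_num : prob_obs thetat s0 y \is a fin_num.
Proof.
rewrite ge0_fin_numE ?ltW//; apply: (@le_lt_trans _ _ 1%:E); last exact: ltry.
apply: (@esum_runs_le _ _ _ s0 _ _ (stopped_prob delta (size y) s0)).
- move=> z Oz; split; first by case: Oz.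
  by rewrite lee_fin prob_joint_le_stopped.
- by move=> p; exact: stopped_prob_ge0.
- by move=> L; exact: total_stopped_prob_le1.
Qed.

Lemma prob_condE z : prob_cond thetat s0 y z =
  (prob_joint thetat y z / fine (prob_obs thetat s0 y))%:E.
Proof.
rewrite /prob_cond -[X in _ / X](fineK prob_obs_fin_num) inver.
by rewrite gt_eqF// fine_gt0// y_pos/= ltey_eq prob_obs_fin_num.
Qed.

Lemma prob_cond_ge0 z : 0 <= prob_cond thetat s0 y z.
Proof.
by rewrite prob_condE lee_fin divr_ge0 ?prob_joint_ge0// fine_ge0// ltW.
Qed.

Lemma weighted_prob_cond_ge0 t z :
  0 <= (occurrences t z)%:R%:E * prob_cond thetat s0 y z.
Proof. by rewrite mule_ge0 ?prob_cond_ge0// lee_fin. Qed.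

Lemma expected_occ_ge0 t : 0 <= E t.
Proof. by apply: esum_ge0 => z _; exact: weighted_prob_cond_ge0. Qed.

Lemma size_steps (z : run S Sigma) : size (steps z) = size z.2.
Proof.
by case: z => s p; rewrite /steps/=; elim: p s => [|[b r] p IHp] s //=; rewrite IHp.
Qed.

(** The count of one transition is at most the length of the run, and posterior weights are at most
    [stopped_prob] divided by P(Y = y). *)
Lemma expected_occ_fin_num (emits : forall s, can_emit delta s) t :
  E t \is a fin_num.
Proof.
have [C lenC] := expected_length_bounded emits (size y) s0.
pose r := fine (prob_obs thetat s0 y).
have r0 : (0 <= r)%R by rewrite fine_ge0// ltW.
rewrite ge0_fin_numE ?expected_occ_ge0//.
apply: (@le_lt_trans _ _ (r^-1 * C)%:E); last exact: ltry.
apply: (@esum_runs_le _ _ _ s0 _ _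
  (fun p => r^-1 * ((size p)%:R * stopped_prob delta (size y) s0 p))%R).
- move=> z Oz; split; first by case: Oz.
  rewrite prob_condE -EFinM lee_fin mulrA mulrC ler_wpM2l ?invr_ge0//.
  apply: ler_pM; rewrite ?prob_joint_ge0// ?prob_joint_le_stopped//.
  by rewrite ler_nat -size_steps count_size.
- by move=> p; rewrite !mulr_ge0 ?invr_ge0 ?stopped_prob_ge0.
- by move=> L; rewrite -mulr_sumr ler_wpM2l ?invr_ge0.
Qed.

(** A run through [t] has a zero factor, and any other run has count 0. This reduces sums over all
    triples to sums over [transitions delta]. *)
Lemma expected_occ_eq0 t : t \notin transitions delta -> E t = 0.
Proof.
rewrite inE -leNgt => t0; apply: esum1 => z _.
case: (boolP (t \in steps z)) => [tz|/count_memPn tz]; last first.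
  by rewrite /occurrences tz mul0e.
rewrite prob_condE /prob_joint; case: ifP => _; last by rewrite mul0r mule0.
suff -> : prob_run thetat z = 0%R by rewrite mul0r mule0.
apply/eqP; rewrite prodf_seq_eq0; apply/hasP; exists t => //=.
by rewrite eq_le t0; case/andP: (pval_itv (delta t.1.1) (t.1.2, t.2)).
Qed.

Lemma big_transitions_from (V : nmodType) (F : transition S Sigma -> V) :
  (\sum_(s : S) \sum_(t in transitions_from delta s) F t =
   \sum_(t in transitions delta) F t)%R.
Proof.
rewrite [RHS](partition_big (fun t => t.1.1) xpredT)//=.
by apply: eq_bigr => s _; apply: eq_bigl => t; rewrite inE.
Qed.

Lemma params_of_setting : parameter_setting delta thetat.
Proof.
split=> [t _|t|s]; first exact: pval_itv.
  rewrite inE -leNgt => t0; apply/eqP; rewrite eq_le t0.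
  by case/andP: (pval_itv (delta t.1.1) (t.1.2, t.2)).
rewrite -[RHS](pval_sum (delta s)).
rewrite [RHS](bigID (fun c => 0 < delta s c)%R)/= [X in _ = (_ + X)%R]big1 ?addr0.
  rewrite (reindex_onto (fun c => (s, c.1, c.2)) (fun t => (t.1.2, t.2)))/=.
    apply: eq_big => [[b r]|[b r] _] //=.
    by rewrite !inE /params_of/= !eqxx !andbT.
  by move=> [[s' b] r]; rewrite !inE => /andP[_ /eqP <-].
move=> c; rewrite -leNgt => c0; apply/eqP; rewrite eq_le c0.
by case/andP: (pval_itv (delta s) c).
Qed.

Lemma QfunE theta : parameter_setting delta theta ->
  Qfun s0 y theta thetat =
  \sum_(s : S) \sum_(t in transitions_from delta s) lne (theta t)%:E * E t.
Proof.
move=> [theta_itv theta_out _].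
have theta01 t : (0 <= theta t <= 1)%R.
  have [/theta_itv//|/theta_out ->] := boolP (t \in transitions delta).
  by rewrite lexx ler01.
(* Since [theta t <= 1], [G] takes values in [0, +oo], so sums over runs and over transitions may be
   exchanged. *)
pose G t := - lne (theta t)%:E.
have G0 t : 0 <= G t by rewrite oppe_ge0 lne_le0 lee_fin; case/andP: (theta01 t).
have GE0 t : 0 <= G t * E t by rewrite mule_ge0// expected_occ_ge0.
pose h z := \sum_t G t * ((occurrences t z)%:R%:E * prob_cond thetat s0 y z).
have Gh0 t z : 0 <= G t * ((occurrences t z)%:R%:E * prob_cond thetat s0 y z).
  by rewrite mule_ge0// weighted_prob_cond_ge0.
rewrite big_transitions_from /Qfun (@signed_esumN _ _ _ _ h); first last.
- by move=> z; apply: sume_ge0.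
- move=> z _; rewrite /h; under eq_bigr do rewrite muleA.
  rewrite -ge0_sume_distrl => [|t _]; last by rewrite mule_ge0// lee_fin.
  rewrite -[X in X * _ = _]oppeK mulNe; congr (- _).
  (* For a run with another observed word the logarithm is [-oo], but the posterior weight 0 absorbs
     it. *)
  rewrite prob_condE /prob_joint; case: ifP => _; last by rewrite mul0r !mule0.
  congr (_ * _); rewrite lne_prod// sum_count_mem.
  by apply: eq_bigr => t _; rewrite muleC.
rewrite esum_sum => [|z t _ _]; last exact: Gh0.
rewrite (eq_bigr (fun t => G t * E t)) => [|t _]; last first.
  by rewrite ge0_esumZl// => z; exact: weighted_prob_cond_ge0.
rewrite -sumeN => [|t u _ _]; last by apply: ge0_adde_def; rewrite inE; exact: GE0.
rewrite (bigID (mem (transitions delta)))/= [X in _ + X]big1 ?adde0.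
  by apply: eq_bigr => t _; rewrite mulNe oppeK.
by move=> t /expected_occ_eq0; rewrite /E => ->; rewrite mule0 oppe0.
Qed.

(** Parameters are real numbers, hence [fine], which loses nothing once the expected counts are
    known to be finite. *)
Definition reestimate (t : transition S Sigma) : R :=
  let d := (\sum_(t' in transitions_from delta t.1.1) fine (E t'))%R in
  if t \in transitions delta then
    if d == 0%R then thetat t else (fine (E t) / d)%R
  else 0%R.

Lemma fine_expected_occ_ge0 t : (0 <= fine (E t))%R.
Proof. by rewrite fine_ge0// expected_occ_ge0. Qed.

Lemma reestimate_from s t : t \in transitions_from delta s ->
  let d := (\sum_(t' in transitions_from delta s) fine (E t'))%R in
  reestimate t = if d == 0%R then thetat t else (fine (E t) / d)%R.
Proof. by rewrite inE /reestimate => /andP[-> /eqP ->]. Qed.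

Lemma reestimate_setting : parameter_setting delta reestimate.
Proof.
have [itv _ sum1] := params_of_setting.
split=> [t tT|t /negbTE|s]; last 2 first.
- by rewrite /reestimate => ->.
- under eq_bigr => t ts do rewrite (reestimate_from ts).
  case: (eqVneq (\sum_(t in transitions_from delta s) fine (E t))%R 0%R) => d0.
    exact: sum1.
  by rewrite -mulr_suml divff.
- have ts : t \in transitions_from delta t.1.1 by rewrite inE tT eqxx.
  rewrite (reestimate_from ts); case: ifPn => [_|dn0]; first exact: itv.
  have d0 : (0 <= \sum_(t' in transitions_from delta t.1.1) fine (E t'))%R.
    by apply: sumr_ge0 => t' _; exact: fine_expected_occ_ge0.
  rewrite divr_ge0 ?fine_expected_occ_ge0//= ler_pdivrMr ?lt0r ?dn0// mul1r.
  by rewrite (bigD1 t)//= lerDl sumr_ge0// => t' _; exact: fine_expected_occ_ge0.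
Qed.

End Posterior.

(** * The formula for [Q] and its maximisation *)

Theorem theorem5p3 (R : realType) (S Sigma : finType)
    (delta : S -> prob_fun R (option Sigma * S)%type)
    (emits : forall s : S, can_emit delta s)
    (s0 : S) (y : seq Sigma)
    (y_pos : 0 < prob_obs (params_of delta) s0 y) :
  let thetat := params_of delta in
  let E := expected_occ thetat s0 y in
  (forall theta : transition S Sigma -> R, parameter_setting delta theta ->
     Qfun s0 y theta thetat =
     \sum_(s : S) \sum_(t in transitions_from delta s) lne (theta t)%:E * E t)
  /\
  (exists thetamax : transition S Sigma -> R,
     [/\ parameter_setting delta thetamax,
         (forall (s : S) (t : transition S Sigma),
            t \in transitions_from delta s ->
            let D := \sum_(t' in transitions_from delta s) E t' in
            (D != 0 -> (thetamax t)%:E = E t / D) /\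
            (D = 0 -> thetamax t = thetat t))
       & forall theta : transition S Sigma -> R, parameter_setting delta theta ->
            Qfun s0 y theta thetat <= Qfun s0 y thetamax thetat]).
Proof.
move=> thetat E.
have Efin t : (fine (E t))%:E = E t.
  by rewrite fineK//; exact: expected_occ_fin_num.
have sumE s : \sum_(t in transitions_from delta s) E t =
    (\sum_(t in transitions_from delta s) fine (E t))%R%:E.
  by rewrite -sumEFin; apply: eq_bigr => t _; rewrite Efin.
split=> [theta|]; first exact: QfunE.
exists (reestimate delta s0 y); split.
- exact: reestimate_setting.
- move=> s t ts D; rewrite /D sumE (reestimate_from _ _ ts) eqe.
  split=> [/[dup] d0 /negbTE -> |-[/eqP ->]] //.
  by rewrite inver (negbTE d0) EFinM Efin.
- move=> theta theta_set; rewrite !QfunE//; last exact: reestimate_setting.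
  (* [Q] splits into one term per state, involving only the transitions leaving it, so the
     comparison is made state by state. *)
  apply: lee_sum => s _; have [d0|dn0] :=
    eqVneq (\sum_(t in transitions_from delta s) fine (E t))%R 0%R.
    apply: lee_sum => t ts.
    (* Nonnegative counts with zero sum all vanish, and then both sides are 0 even where a logarithm
       is [-oo]. *)
    have e0 : fine (E t) = 0%R.
      by apply: (psumr_eq0P _ d0) => // u _; exact: fine_expected_occ_ge0.
    by rewrite -[expected_occ _ _ _ _]Efin -/E e0 !mule0.
  have [itv _ sum1] := theta_set.
  have ge0 : {in transitions_from delta s, forall t, 0 <= theta t}%R.
    by move=> t; rewrite inE => /andP[/itv/andP[]].
  have e_ge0 : {in transitions_from delta s, forall t, 0 <= fine (E t)}%R.
    by move=> t _; exact: fine_expected_occ_ge0.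
  have := gibbs_inequality e_ge0 ge0 _ dn0; rewrite sum1 => /(_ (lexx _)).
  congr (_ <= _); apply: eq_bigr => t ts; rewrite Efin//.
  by rewrite (reestimate_from _ _ ts) (negbTE dn0).
Qed.
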